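(* Let $p$ be a positive prime integer, $\epsilon$ a generator of $\mathbb{U}_p$, $M$ a divisor of $p-1$, $\mathbb{M}$ a multiplicative subgroup of $\mathbb{U}_p$ of order $M$, and $a:=\frac{p-1}{M}$ the index of $\mathbb{M}$ in $\mathbb{U}_p$. Let $\Delta_{\mathbb{M}}:=\mathbb{M}\times\mathbb{Z}_p$ and let $\mathbf{y}\in\mathbb{C}^p$ be a non-zero window signal. The finite wavelet system $\mathcal{W}(\mathbf{y},\Delta_{\mathbb{M}})$ is a frame for $\mathbb{C}^p$ if and only if $\widehat{\mathbf{y}}(0)\neq 0$ and the matrix $\mathbf{Y}(\mathbb{M},\mathbf{y})$ of size $a\times M$ given by $$\mathbf{Y}(\mathbb{M},\mathbf{y}):=\begin{bmatrix}\widehat{\mathbf{y}}(1)&\widehat{\mathbf{y}}(\epsilon^{a})&\cdots&\widehat{\mathbf{y}}(\epsilon^{(M-1)a})\\ \widehat{\mathbf{y}}(\epsilon^{1})&\widehat{\mathbf{y}}(\epsilon^{a+1})&\cdots&\widehat{\mathbf{y}}(\epsilon^{(M-1)a+1})\\ \vdots&\vdots&\ddots&\vdots\\ \widehat{\mathbf{y}}(\epsilon^{a-1})&\widehat{\mathbf{y}}(\epsilon^{2a-1})&\cdots&\widehat{\mathbf{y}}(\epsilon^{Ma-1})\end{bmatrix}_{a\times M}$$ (that is, the matrix whose entry in row $t\in\{0,\ldots,a-1\}$ and column $j\in\{0,\ldots,M-1\}$ is $\widehat{\mathbf{y}}(\epsilon^{ja+t})$) is such that each row has at least one non-zero entry.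
   Context: For a prime $p$, $\mathbb{Z}_p=\{0,\ldots,p-1\}$ denotes the integers modulo $p$ and $\mathbb{U}_p=\mathbb{Z}_p\setminus\{0\}$ is the multiplicative group modulo $p$ (cyclic of order $p-1$). $\mathbb{C}^p$ denotes the space of functions $\mathbf{x}:\mathbb{Z}_p\to\mathbb{C}$ with inner product $\langle\mathbf{x},\mathbf{y}\rangle=\sum_{k=0}^{p-1}\mathbf{x}(k)\overline{\mathbf{y}(k)}$ and induced norm $\|\cdot\|_2$. For $k\in\mathbb{Z}_p$ the translation operator is $T_k\mathbf{x}(s)=\mathbf{x}(s-k)$, and for $m\in\mathbb{U}_p$ the cyclic dilation operator is $D_m\mathbf{x}(s)=\mathbf{x}(m_p s)$, where $m_p$ is the inverse of $m$ in $\mathbb{U}_p$ (all arguments modulo $p$). The unitary discrete Fourier transform of $\mathbf{x}$ is $\widehat{\mathbf{x}}(\ell)=\frac{1}{\sqrt{p}}\sum_{k=0}^{p-1}\mathbf{x}(k)e^{-2\pi i\ell k/p}$ for $\ell\in\mathbb{Z}_p$. A window signal is just a vector of $\mathbb{C}^p$. For $\Delta\subseteq\mathbb{U}_p\times\mathbb{Z}_p$, the finite wavelet system is the family $\mathcal{W}(\mathbf{y},\Delta)=\{T_kD_m\mathbf{y}:(m,k)\in\Delta\}$, indexed by $\Delta$. A finite family $\{\mathbf{y}_j\}_{j=0}^{N-1}$ in $\mathbb{C}^p$ is a frame for $\mathbb{C}^p$ if there is a constant $0<A<\infty$ with $A\|\mathbf{x}\|_2^2\le\sum_{j=0}^{N-1}|\langle\mathbf{x},\mathbf{y}_j\rangle|^2$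 for all $\mathbf{x}\in\mathbb{C}^p$. *)

(* Defs.v *)
From HB Require Import structures.
From mathcomp Require Import all_boot all_order all_algebra all_fingroup all_solvable.
From mathcomp Require Import complex.
From mathcomp Require Import reals trigo.

Set Implicit Arguments.
Unset Strict Implicit.
Unset Printing Implicit Defensive.

Import Order.TTheory GRing.Theory Num.Theory.
Local Open Scope ring_scope.
Local Open Scope complex_scope.

(* Z_p is 'F_p and U_p is {unit 'F_p}: both are meaningful only for prime p. *)
Notation signal R p := {ffun 'F_p -> R[i]}.

Section Signals.
Variables (R : realType) (p : nat).
Implicit Types x y : signal R p.

Definition inner x y : R[i] := \sum_(k : 'F_p) x k * Num.conj (y k).

Definition norm2 x : R[i] := sqrtC (inner x x).

Definition translation (k : 'F_p) x : signal R p := [ffun s => x (s - k)].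

Definition dilation (m : {unit 'F_p}) x : signal R p :=
  [ffun s => x (val (m^-1)%g * s)].

Definition expi (t : R) : R[i] := cos t +i* sin t.

(* In the exponent the residues l and k are read as naturals in [0, p[. *)
Definition dft x : signal R p :=
  [ffun l : 'F_p => ((Num.sqrt p%:R)^-1)%:C *
     \sum_(k : 'F_p) x k * expi (- (2 * pi * (l : nat)%:R * (k : nat)%:R / p%:R))].

Definition wavelet_system y (Delta : {set {unit 'F_p} * 'F_p}) :
    {mk | mk \in Delta} -> signal R p :=
  fun mk => translation (val mk).2 (dilation (val mk).1 y).

(* Both sides of the inequality are real, so that the partial order of R[i]
   compares them as elements of R. *)
Definition is_frame (J : finType) (f : J -> signal R p) : Prop :=
  exists2 A : R, 0 < A &
    forall x, A%:C * norm2 x ^+ 2 <= \sum_(j : J) `|inner x (f j)| ^+ 2.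

Definition Ymx (a M : nat) (eps : {unit 'F_p}) y : 'M[R[i]]_(a, M) :=
  \matrix_(t < a, j < M) dft y (val (eps ^+ (j * a + t))%g).

End Signals.

Arguments wavelet_system {R p} y Delta _.

(* Main.v *)
Require Import Defs.
From HB Require Import structures.
From mathcomp Require Import all_boot all_order all_algebra all_fingroup all_solvable.
From mathcomp Require Import complex.
From mathcomp Require Import reals trigo.

Set Implicit Arguments.
Unset Strict Implicit.
Unset Printing Implicit Defensive.

Import Order.TTheory GRing.Theory Num.Theory.
Local Open Scope ring_scope.
Local Open Scope complex_scope.

(** The Fourier transform diagonalises the system. For a fixed dilation m, the
    coefficients <x, T_k D_m y>, seen as a function of the translation k, form
    the cross-correlation of x and D_m y, so by Plancherel their energy is
    1/p times the sum over l of |X(l)|^2 |Y(m l)|^2, where X and Y are the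
    unnormalised transforms of x and y. Summing over m gives
    [wavelet_energy]: the total energy is that of X weighted at frequency l by
    [wavelet_symbol] l, the sum of |Y(m l)|^2 over m in the subgroup. Since
    X can be concentrated at a single frequency, the lower frame bound holds if
    and only if no weight vanishes, and the best bound is then the smallest
    weight ([wavelet_frameP]).

    The weight at l vanishes exactly when Y vanishes on the orbit of l under
    the subgroup. The orbit of 0 is {0}, which gives the condition on Y(0).
    The other orbits are the cosets of the subgroup; as the group is cyclic,
    the subgroup is generated by eps^a ([generator_subgroup]), so its cosets
    are {eps^(j a + t)} for t < a, and these are the index sets of the rows of
    the matrix. *)

(** * The root of unity exp(-2 pi i / p) *)

Section RootOfUnity.
Variables (R : realType) (p : nat).

Lemma expiD (s t : R) : expi (s + t) = expi s * expi t.
Proof.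
by rewrite /expi cosD sinD; simpc; congr (_ +i* _); rewrite addrC.
Qed.

Lemma expi_mulrn (t : R) n : expi (n%:R * t) = expi t ^+ n.
Proof.
elim: n => [|n IHn]; first by rewrite mul0r expr0 /expi cos0 sin0.
by rewrite exprS -IHn -expiD -natr1 mulrDl mul1r addrC.
Qed.

Definition omega : R[i] := expi (- (2 * pi / p%:R)).

Lemma omega_expn : (0 < p)%N -> omega ^+ p = 1.
Proof.
move=> p_gt0; rewrite -expi_mulrn mulrN mulrC divfK ?pnatr_eq0 -?lt0n //.
by rewrite /expi cosN sinN mulr_natl cos2pi sin2pi oppr0.
Qed.

Lemma omega_neq1 : (1 < p)%N -> omega != 1.
Proof.
move=> p_gt1; apply/eqP => -[]; rewrite cosN => cos_eq _.
have p0 : 0 < p%:R :> R by rewrite ltr0n ltnW.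
have t_gt0 : 0 < 2 * pi / p%:R :> R by rewrite divr_gt0 ?mulr_gt0 ?pi_gt0.
have t_le : 2 * pi / p%:R <= pi :> R.
  by rewrite ler_pdivrMr // mulrC ler_pM2l ?pi_gt0 // ler_nat.
suff t0 : 2 * pi / p%:R = 0 :> R by rewrite t0 ltxx in t_gt0.
by apply: cos_inj; rewrite ?cos_eq ?cos0 // in_itv /= ?lexx ?pi_ge0 // ltW.
Qed.

End RootOfUnity.

(** * Additive characters and Plancherel's formula *)

Section FourierTransform.
Variables (R : realType) (p : nat) (p_pr : prime p).

(** Defined on representatives in [0, p[; it is a character of the additive
    group because [omega] is a p-th root of unity. *)
Definition echar (z : 'F_p) : R[i] := omega R p ^+ (z : nat).

Lemma echar_nat n : echar n%:R = omega R p ^+ n.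
Proof.
have /expr_mod mod_p := omega_expn R (prime_gt0 p_pr).
by rewrite -[RHS]mod_p /echar val_Fp_nat.
Qed.

Lemma echarD : {morph echar : x y / x + y >-> x * y}.
Proof.
by move=> x y; rewrite -exprD -echar_nat natrD !natr_Zp.
Qed.

Lemma echar0 : echar 0 = 1. Proof. exact: expr0. Qed.

Lemma echar1_neq1 : echar 1 != 1.
Proof. exact/omega_neq1/prime_gt1. Qed.

Lemma norm_echar x : `|echar x| = 1.
Proof.
have p_gt0 := prime_gt0 p_pr.
apply/eqP; rewrite normrX; suff /eqP-> : `|omega R p| == 1 by rewrite expr1n.
by rewrite -(pexpr_eq1 p_gt0) // -normrX omega_expn // normr1.
Qed.

Lemma conj_echar x : Num.conj (echar x) = echar (- x).
Proof.
have := normCK (echar x); rewrite norm_echar expr1n => e1.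
have x_neq0 : echar x != 0 by rewrite -normr_eq0 norm_echar oner_eq0.
by apply: (mulfI x_neq0); rewrite -e1 -echarD subrr echar0.
Qed.

Lemma sum_echar l : \sum_(k : 'F_p) echar (l * k) = (l == 0)%:R * p%:R.
Proof.
have [->|l0] := eqVneq l 0.
  rewrite (eq_bigr (fun=> 1)) => [|k _]; last by rewrite mul0r echar0.
  by rewrite sumr_const card_Fp // mul1r.
(* Translating the summation index by l^-1 multiplies the sum by echar 1. *)
have sumE : \sum_k echar (l * k) = echar 1 * \sum_k echar (l * k).
  rewrite [LHS](reindex_inj (addrI l^-1)) mulr_sumr.
  by apply: eq_bigr => k _; rewrite mulrDr mulfV // echarD.
apply/eqP; rewrite mul0r; apply: contraNT echar1_neq1 => sum_neq0.
by apply/eqP/(mulIf sum_neq0); rewrite mul1r -sumE.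
Qed.

(** The transform without the factor 1/sqrt p, so that no square root enters
    the computations; it is stated on plain functions so as to apply to
    correlations as well as to signals. *)
Definition fourier (x : 'F_p -> R[i]) (l : 'F_p) : R[i] :=
  \sum_(k : 'F_p) x k * echar (l * k).

Lemma dftE (x : signal R p) l :
  dft x l = ((Num.sqrt p%:R)^-1)%:C * fourier x l.
Proof.
rewrite ffunE; congr (_ * _); apply: eq_bigr => k _; congr (_ * _).
rewrite -[in RHS](natr_Zp l) -[in RHS](natr_Zp k) -natrM echar_nat.
rewrite -expi_mulrn natrM mulrN; congr (expi (- _)).
by rewrite -[2 * pi * _ * _]mulrA mulrAC mulrC.
Qed.

Lemma dft_eq0 (x : signal R p) l : (dft x l == 0) = (fourier x l == 0).
Proof.
have p_gt0 := prime_gt0 p_pr.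
rewrite dftE mulf_eq0 fmorph_eq0 invr_eq0 sqrtr_eq0.
by rewrite leNgt ltr0n p_gt0.
Qed.

(** Expanding the square and summing over l first leaves, by orthogonality of
    the characters, only the diagonal terms. *)
Lemma plancherel x : \sum_l `|fourier x l| ^+ 2 = p%:R * \sum_k `|x k| ^+ 2.
Proof.
have sqE l : `|fourier x l| ^+ 2 =
    \sum_k \sum_j x k * Num.conj (x j) * echar ((k - j) * l).
  rewrite normCK rmorph_sum mulr_suml; apply: eq_bigr => k _.
  rewrite mulr_sumr; apply: eq_bigr => j _.
  by rewrite rmorphM /= conj_echar mulrACA -echarD -mulrBr [l * _]mulrC.
rewrite (eq_bigr _ (fun l _ => sqE l)) exchange_big mulr_sumr /=.
apply: eq_bigr => k _; rewrite exchange_big (bigD1 k) //=.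
rewrite [X in _ + X]big1 => [|j jk].
  by rewrite addr0 -mulr_sumr subrr sum_echar eqxx mul1r mulrC normCK.
by rewrite -mulr_sumr sum_echar subr_eq0 eq_sym (negPf jk) mul0r mulr0.
Qed.

Lemma norm2_sq (x : signal R p) : norm2 x ^+ 2 = \sum_k `|x k| ^+ 2.
Proof. by rewrite sqrtCK; apply: eq_bigr => k _; rewrite normCK. Qed.

(** The coefficients of x against the translates of g are the values of their
    cross-correlation, and correlation becomes a product on the Fourier
    side. *)
Lemma fourier_correlation (x g : signal R p) l :
  fourier (fun k => inner x (translation k g)) l =
    fourier x l * Num.conj (fourier g l).
Proof.
rewrite /fourier rmorph_sum mulr_suml.
under eq_bigr do rewrite mulr_suml.
rewrite exchange_big; apply: eq_bigr => s _ /=.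
rewrite (reindex_inj (can_inj (subKr s))) mulr_sumr.
apply: eq_bigr => u _; rewrite ffunE subKr rmorphM /= conj_echar.
by rewrite mulrBr echarD mulrACA.
Qed.

Lemma fourier_dilation m (y : signal R p) l :
  fourier (dilation m y) l = fourier y (val m * l).
Proof.
have m_unit := valP m.
rewrite /fourier (reindex_inj (mulrI m_unit)); apply: eq_bigr => k _.
by rewrite ffunE FinRing.val_unitV mulKr // mulrA [l * _]mulrC.
Qed.

(** * The frame bound on the Fourier side *)

(** The eigenvalue of the frame operator of the wavelet system on the character
    of frequency l. *)
Definition wavelet_symbol (MM : {set {unit 'F_p}}) (y : signal R p) l : R[i] :=
  \sum_(m in MM) `|fourier y (val m * l)| ^+ 2.

(** Plancherel in the translation parameter, for each dilation separately. *)
Lemma wavelet_energy (MM : {set {unit 'F_p}}) (x y : signal R p) :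
  p%:R * \sum_j `|inner x (wavelet_system y (setX MM [set: 'F_p]) j)| ^+ 2 =
    \sum_l `|fourier x l| ^+ 2 * wavelet_symbol MM y l.
Proof.
pose F mk := `|inner x (translation mk.2 (dilation mk.1 y))| ^+ 2.
transitivity (p%:R * \sum_(m in MM) \sum_k F (m, k)).
  congr (_ * _); rewrite -(big_sub _ F) pair_big.
  by apply: eq_big => [[m k]|[m k] _] //; rewrite !inE /= andbT.
rewrite mulr_sumr; under [RHS]eq_bigr do rewrite mulr_sumr.
rewrite exchange_big; apply: eq_bigr => m _ /=.
rewrite -(plancherel (fun k => inner x (translation k (dilation m y)))).
apply: eq_bigr => l _.
by rewrite fourier_correlation fourier_dilation normrM norm_conjC exprMn.
Qed.

Lemma wavelet_symbol_ge0 MM (y : signal R p) l : 0 <= wavelet_symbol MM y l.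
Proof. by apply: sumr_ge0 => m _; rewrite exprn_ge0. Qed.

(** If the symbol vanishes at l, the character of frequency l is orthogonal to
    the whole system; otherwise the minimum of the symbol over the finitely
    many frequencies is a frame bound. *)
Lemma wavelet_frameP (MM : {set {unit 'F_p}}) (y : signal R p) :
  is_frame (wavelet_system y (setX MM [set: 'F_p])) <->
  forall l, wavelet_symbol MM y l != 0.
Proof.
have p_gt0 : 0 < p%:R :> R[i] by rewrite ltr0n prime_gt0.
split=> [[A A_gt0 frameA] l|W_neq0].
  apply/eqP=> Wl0; pose x : signal R p := [ffun k => echar (- (l * k))].
  have x_hat j : fourier x j = (j == l)%:R * p%:R.
    rewrite -subr_eq0 -sum_echar; apply: eq_bigr => k _.
    by rewrite ffunE -echarD mulrBl addrC.
  have energy0 :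
      \sum_j `|inner x (wavelet_system y (setX MM [set: 'F_p]) j)| ^+ 2 = 0.
    apply: (mulfI (lt0r_neq0 p_gt0)); rewrite wavelet_energy mulr0.
    rewrite big1 // => j _.
    rewrite x_hat; have [->|_] := eqVneq j l; first by rewrite Wl0 mulr0.
    by rewrite mul0r normr0 expr0n mul0r.
  have normx : norm2 x ^+ 2 = p%:R.
    rewrite norm2_sq (eq_bigr (fun=> 1)) ?sumr_const ?card_Fp // => k _.
    by rewrite ffunE norm_echar expr1n.
  have := frameA x; rewrite energy0 normx.
  by rewrite pmulr_lle0 // -[0]/(0%:C) lecR leNgt A_gt0.
pose W l := complex.Re (wavelet_symbol MM y l).
have WE l : (W l)%:C = wavelet_symbol MM y l.
  by rewrite /W RRe_real // ger0_real ?wavelet_symbol_ge0.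
have W_gt0 l : 0 < W l.
  by rewrite -ltcR WE lt_def W_neq0 wavelet_symbol_ge0.
have [l0 _ W_min] := arg_minP W (isT : xpredT (0 : 'F_p)).
exists (W l0) => // x; rewrite -(ler_pM2l p_gt0) wavelet_energy.
rewrite mulrCA norm2_sq -plancherel mulr_sumr; apply: ler_sum => l _.
by rewrite mulrC -WE ler_wpM2l ?exprn_ge0 // lecR W_min.
Qed.

End FourierTransform.

(** * Orbits of the subgroup and rows of the matrix *)

(** A cyclic group has a single subgroup of each order, so comparing orders
    suffices. *)
Lemma generator_subgroup (gT : finGroupType) (G H : {group gT}) e :
  generator G e -> H \subset G -> H :=: <[e ^+ (#|G| %/ #|H|)]>%g.
Proof.
move=> /eqP genG sHG; have dHG := cardSg sHG.
have eG : e \in G by rewrite genG cycle_id.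
have ordE : #[e]%g = #|G| by rewrite genG.
have cG : cyclic G by rewrite genG cycle_cyclic.
apply/eqP; rewrite (eq_subG_cyclic cG) ?cycle_subG ?groupX //.
rewrite -[#|<[_]>%g|]/#[_]%g orderXdiv ordE ?dvdn_div //.
by rewrite divnA // mulKn.
Qed.

Lemma wavelet_symbol_neq0P (R : realType) p (MM : {set {unit 'F_p}})
    (y : signal R p) l :
  reflect (exists2 m, m \in MM & fourier y (val m * l) != 0)
          (wavelet_symbol MM y l != 0).
Proof.
have posE (z : R[i]) : (0 < `|z| ^+ 2) = (z != 0).
  by rewrite lt_def exprn_ge0 // andbT expf_eq0 /= normr_eq0.
rewrite psumr_neq0 => [|m _]; last by rewrite exprn_ge0.
apply: (iffP hasP) => [[m _]|[m mM ym]].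
  by rewrite posE => /andP[]; exists m.
by exists m; rewrite ?mem_index_enum // posE mM.
Qed.

Theorem corollary3p12 (R : realType) (p : nat) (hp : prime p)
    (eps : {unit 'F_p}) (heps : generator [set: {unit 'F_p}] eps)
    (M : nat) (hM : (M %| p.-1)%N)
    (MM : {group {unit 'F_p}}) (hMM : #|MM| = M)
    (y : signal R p) (hy : y != 0) :
  let a := (p.-1 %/ M)%N in
  is_frame (wavelet_system y (setX MM [set: 'F_p])) <->
  dft y 0 != 0 /\
  forall t : 'I_a, exists j : 'I_M, Ymx a M eps y t j != 0.
Proof.
move=> a; have cardU : #|[set: {unit 'F_p}]| = p.-1.
  by rewrite card_finField_unit card_Fp.
have MM_cycle : MM :=: <[eps ^+ a]>%g.
  by rewrite /a -hMM -cardU; apply: generator_subgroup heps (subsetT _).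
have ord_epsa : #[eps ^+ a]%g = M by rewrite -hMM MM_cycle.
have a_gt0 : (0 < a)%N.
  rewrite divn_gt0 -hMM ?cardG_gt0 // -cardU.
  by rewrite subset_leq_card ?subsetT.
rewrite (wavelet_frameP hp); split=> [W_neq0|[y0 rows] l].
  split=> [|t].
    rewrite dft_eq0 //; have /wavelet_symbol_neq0P[m _] := W_neq0 0.
    by rewrite mulr0.
  (* Row t runs over the orbit of eps ^ t. *)
  have /wavelet_symbol_neq0P[m] := W_neq0 (val (eps ^+ t)%g).
  rewrite MM_cycle => /cyclePmin[j]; rewrite ord_epsa => ltjM -> yj.
  exists (Ordinal ltjM); rewrite mxE dft_eq0 //=.
  by rewrite expgD mulnC expgM FinRing.val_unitM.
apply/wavelet_symbol_neq0P; have [->|l_neq0] := eqVneq l 0.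
  by exists 1%g; rewrite ?group1 // mulr0 -dft_eq0.
have l_unit : l \is a GRing.unit by rewrite unitfE.
have [n ln] : exists n, FinRing.unit 'F_p l_unit = (eps ^+ n)%g.
  by apply/cycleP; rewrite -(eqP heps) inE.
(* The unit l = eps ^ n is in the coset of eps ^ (n mod a), and the quotient
   n / a is the power of eps ^ a to be compensated. *)
have [j] := rows (Ordinal (ltn_pmod n a_gt0)).
rewrite mxE dft_eq0 //= => yj.
exists ((eps ^+ a) ^+ j * ((eps ^+ a) ^+ (n %/ a))^-1)%g.
  by rewrite MM_cycle groupM ?groupV ?mem_cycle.
have -> : l = val ((eps ^+ a) ^+ (n %/ a) * eps ^+ (n %% a))%g.
  by rewrite -expgM -expgD mulnC -divn_eq -ln.
by rewrite -FinRing.val_unitM mulgA mulgKV -expgM -expgD mulnC.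
Qed.
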